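(* Let $\mathbb{K}$ be an algebraically closed field of characteristic zero, let $A$ be a finite-dimensional $\mathbb{K}$-vector space, and let $(A,[\cdot,\cdot]_A)$ and $(A^*,[\cdot,\cdot]_{A^*})$ be left-Alia algebras. Then there is a Manin triple of left-Alia algebras $\big((A\oplus A^*,[\cdot,\cdot]_d,\mathcal{B}_d),A,A^*\big)$ if and only if $$\big((A,[\cdot,\cdot]_A),(A^*,[\cdot,\cdot]_{A^*}),\mathcal{L}^*_{[\cdot,\cdot]_A},\mathcal{L}^*_{[\cdot,\cdot]_A}-\mathcal{R}^*_{[\cdot,\cdot]_A},\mathcal{L}^*_{[\cdot,\cdot]_{A^*}},\mathcal{L}^*_{[\cdot,\cdot]_{A^*}}-\mathcal{R}^*_{[\cdot,\cdot]_{A^*}}\big)$$ is a matched pair of left-Alia algebras.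
   Context: A left-Alia algebra is a vector space $A$ with a bilinear map $[\cdot,\cdot]:A\times A\to A$ such that $[[x,y],z]+[[y,z],x]+[[z,x],y]=[[y,x],z]+[[z,y],x]+[[x,z],y]$ for all $x,y,z\in A$. For a bilinear map $[\cdot,\cdot]$ on a vector space $A$, put $\mathcal{L}_{[\cdot,\cdot]}(x)y=[x,y]=\mathcal{R}_{[\cdot,\cdot]}(y)x$. For a linear map $l:A\to\mathrm{End}(V)$, $l^*:A\to\mathrm{End}(V^* )$ is defined by $\langle l^*(x)u^*,v\rangle=-\langle u^*,l(x)v\rangle$ (note the sign). Thus $\mathcal{L}^*_{[\cdot,\cdot]_A},\mathcal{R}^*_{[\cdot,\cdot]_A}:A\to\mathrm{End}(A^* )$ and, with $A^{**}=A$, $\mathcal{L}^*_{[\cdot,\cdot]_{A^*}},\mathcal{R}^*_{[\cdot,\cdot]_{A^*}}:A^*\to\mathrm{End}(A)$. Matched pair: for left-Alia algebras $(A,[\cdot,\cdot]_A)$, $(B,[\cdot,\cdot]_B)$ and linear maps $l_A,r_A:A\to\mathrm{End}(B)$, $l_B,r_B:B\to\mathrm{End}(A)$, the tuple $((A,[\cdot,\cdot]_A),(B,[\cdot,\cdot]_B),l_A,r_A,l_B,r_B)$ is a matched pair of left-Alia algebras if $$[x+a,y+b]_{A\oplus B}=[x,y]_A+l_B(a)y+r_B(b)x+[a,b]_B+l_A(x)b+r_A(y)a\quad(x,y\in A,\ a,b\in B)$$ is a left-Alia algebra structure on $A\oplus B$. A quadratic left-Alia algebra is a left-Alia algebra $(\mathfrak{d},[\cdot,\cdot])$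 with a nondegenerate symmetric bilinear form $\mathcal{B}$ satisfying $\mathcal{B}([x,y],z)=\mathcal{B}(x,[z,y]-[y,z])$ for all $x,y,z$. A Manin triple of left-Alia algebras $\big((A\oplus A^*,[\cdot,\cdot]_d,\mathcal{B}_d),A,A^*\big)$ is a left-Alia algebra structure $[\cdot,\cdot]_d$ on $A\oplus A^*$ containing $(A,[\cdot,\cdot]_A)$ and $(A^*,[\cdot,\cdot]_{A^*})$ as left-Alia subalgebras and such that $(A\oplus A^*,[\cdot,\cdot]_d,\mathcal{B}_d)$ is a quadratic left-Alia algebra, where $\mathcal{B}_d(x+a^*,y+b^* )=\langle x,b^*\rangle+\langle a^*,y\rangle$. *)

(* Defs.v *)
From HB Require Import structures.
From mathcomp Require Import all_boot all_order all_algebra.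
Set Implicit Arguments.
Unset Strict Implicit.
Unset Printing Implicit Defensive.
Import GRing.Theory.
Local Open Scope ring_scope.

Section LeftAlia.
Variable K : fieldType.

Definition left_alia (A : vectType K) (br : {bilinear A -> A -> A}) : Prop :=
  forall x y z : A,
    br (br x y) z + br (br y z) x + br (br z x) y =
    br (br y x) z + br (br z y) x + br (br x z) y.

(* [linfun f] agrees with [f] only when [f] is linear; every use of [linfun]
   below is justified by one of the evaluation lemmas [Lmul_E], [Rmul_E],
   [dual_repE], [bidual_evE], [predual_repE]. *)

Section Multiplications.
Variables (A : vectType K) (br : {bilinear A -> A -> A}).

Definition Lmul : 'Hom(A, 'End(A)) := linfun (fun x => linfun (br x)).

Definition Rmul : 'Hom(A, 'End(A)) := linfun (fun y => linfun (br^~ y)).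

Lemma Lmul_E x y : Lmul x y = br x y.
Proof.
have linL : linear (fun x => linfun (br x)).
  move=> c u v; apply/lfunP => w.
  by rewrite add_lfunE scale_lfunE !lfunE /= linearPl.
pose L := GRing.isLinear.Build _ _ _ _ _ linL.
pose f : {linear A -> 'End(A)} := HB.pack (fun x => linfun (br x)) L.
by rewrite /Lmul (lfunE f) /= lfunE.
Qed.

Lemma Rmul_E x y : Rmul y x = br x y.
Proof.
have linR1 z : linfun (br^~ z) =1 br^~ z by exact: (lfunE (applyr br z)).
have linR : linear (fun y => linfun (br^~ y)).
  move=> c u v; apply/lfunP => w.
  by rewrite add_lfunE scale_lfunE !linR1 linearPr.
pose L := GRing.isLinear.Build _ _ _ _ _ linR.
pose f : {linear A -> 'End(A)} := HB.pack (fun y => linfun (br^~ y)) L.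
by rewrite /Rmul (lfunE f) /= linR1.
Qed.

End Multiplications.

Definition dual (V : vectType K) : vectType K := 'Hom(V, K^o).

Definition pairing (V : vectType K) (u : dual V) (v : V) : K := u v.

Section DualRepresentation.
Variables (A V : vectType K) (l : 'Hom(A, 'End(V))).

Definition dual_rep : 'Hom(A, 'End(dual V)) :=
  linfun (fun x => linfun (fun u : dual V => (- (u \o l x))%VF : dual V)).

Lemma dual_repE x (u : dual V) (v : V) :
  pairing (dual_rep x u) v = - pairing u (l x v).
Proof.
have lin1 z : linear (fun u : dual V => (- (u \o l z))%VF : dual V).
  move=> c a b; apply/lfunP => w.
  by rewrite !(opp_lfunE, add_lfunE, scale_lfunE, comp_lfunE) opprD scalerN.
have E1 z (a : dual V) :
    linfun (fun u : dual V => (- (u \o l z))%VF : dual V) a = (- (a \o l z))%VF.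
  pose L := GRing.isLinear.Build _ _ _ _ _ (lin1 z).
  pose f : {linear dual V -> dual V} :=
    HB.pack (fun u : dual V => (- (u \o l z))%VF : dual V) L.
  exact: (lfunE f).
have lin2 : linear (fun x =>
    linfun (fun u : dual V => (- (u \o l x))%VF : dual V)).
  move=> c a b; apply/lfunP => w; apply/lfunP => t.
  rewrite !(add_lfunE, scale_lfunE, E1, opp_lfunE, comp_lfunE).
  by rewrite linearP /= add_lfunE scale_lfunE linearP opprD scalerN.
pose L := GRing.isLinear.Build _ _ _ _ _ lin2.
pose f : {linear A -> 'End(dual V)} := HB.pack (fun x =>
    linfun (fun u : dual V => (- (u \o l x))%VF : dual V)) L.
by rewrite /pairing /dual_rep (lfunE f) /= E1 opp_lfunE comp_lfunE.
Qed.

End DualRepresentation.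

Lemma dim_dual (V : vectType K) : \dim {: dual V} = \dim {: V}.
Proof. by rewrite !dimvf /dim /= muln1. Qed.

Section Bidual.
Variable V : vectType K.

Definition bidual_ev : 'Hom(V, dual (dual V)) :=
  linfun (fun v => linfun (fun u : dual V => pairing u v : K^o)).

Lemma bidual_evE v (u : dual V) : pairing (bidual_ev v) u = pairing u v.
Proof.
have lin1 z : linear (fun u : dual V => pairing u z : K^o).
  by move=> c a b; rewrite /pairing add_lfunE scale_lfunE.
have E1 z (a : dual V) :
    linfun (fun u : dual V => pairing u z : K^o) a = pairing a z.
  pose L := GRing.isLinear.Build _ _ _ _ _ (lin1 z).
  pose f : {linear dual V -> K^o} :=
    HB.pack (fun u : dual V => pairing u z : K^o) L.
  exact: (lfunE f).
have lin2 : linear (fun v => linfun (fun u : dual V => pairing u v : K^o)).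
  move=> c a b; apply/lfunP => w.
  by rewrite !(add_lfunE, scale_lfunE, E1) /pairing linearP.
pose L := GRing.isLinear.Build _ _ _ _ _ lin2.
pose f : {linear V -> dual (dual V)} :=
  HB.pack (fun v => linfun (fun u : dual V => pairing u v : K^o)) L.
by rewrite /pairing /bidual_ev (lfunE f) /= E1.
Qed.

Lemma bidual_ev_inj : lker bidual_ev == 0%VS.
Proof.
rewrite -subv0; apply/subvP => v; rewrite memv_ker memv0 => /eqP ev0.
apply/eqP; rewrite (coord_vbasis (memvf v)).
apply: big1 => i _.
have lin : linear (coord (vbasis fullv) i : V -> K^o).
  by move=> c a b; rewrite linearP.
pose L := GRing.isLinear.Build _ _ _ _ _ lin.
pose f : {linear V -> K^o} :=
  HB.pack (coord (vbasis fullv) i : V -> K^o) L.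
have := bidual_evE v (linfun f); rewrite ev0 /pairing zero_lfunE lfunE /= => <-.
by rewrite scale0r.
Qed.

Lemma bidual_evK : cancel bidual_ev (bidual_ev^-1)%VF.
Proof. exact: lker0_lfunK bidual_ev_inj. Qed.

Lemma bidual_evVK : cancel (bidual_ev^-1)%VF bidual_ev.
Proof.
move=> w; apply: limg_lfunVK.
suff -> : limg bidual_ev = fullv by exact: memvf.
apply/eqP; rewrite eqEdim subvf /= limg_dim_eq ?(eqP bidual_ev_inj) ?capv0 //.
have /eq_leq := etrans (dim_dual (dual V)) (dim_dual V); exact.
Qed.

End Bidual.

(* For [l : A -> End(V^* )], the map [l^* : A -> End(V)] obtained from
   [dual_rep l : A -> End(V^** )] through the identification [V^** = V]. *)
Definition predual_rep (A V : vectType K) (l : 'Hom(A, 'End(dual V))) :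
    'Hom(A, 'End(V)) :=
  linfun (fun x => ((bidual_ev V)^-1 \o dual_rep l x \o bidual_ev V)%VF).

Lemma predual_repE (A V : vectType K) (l : 'Hom(A, 'End(dual V))) x v u :
  pairing u (predual_rep l x v) = - pairing (l x u) v.
Proof.
have lin : linear (fun x =>
    ((bidual_ev V)^-1 \o dual_rep l x \o bidual_ev V)%VF).
  move=> c a b; apply/lfunP => w.
  rewrite !(add_lfunE, scale_lfunE, comp_lfunE) (linearP (dual_rep l)).
  by rewrite add_lfunE scale_lfunE linearP.
pose L := GRing.isLinear.Build _ _ _ _ _ lin.
pose f : {linear A -> 'End(V)} := HB.pack (fun x =>
    ((bidual_ev V)^-1 \o dual_rep l x \o bidual_ev V)%VF) L.
rewrite /predual_rep (lfunE f) /= !comp_lfunE /=.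
by rewrite -bidual_evE bidual_evVK dual_repE bidual_evE.
Qed.

Section MatchedPair.
Variables (A B : vectType K).
Variables (brA : {bilinear A -> A -> A}) (brB : {bilinear B -> B -> B}).
Variables (lA rA : 'Hom(A, 'End(B))) (lB rB : 'Hom(B, 'End(A))).

Definition sum_bracket (u v : A * B) : A * B :=
  (brA u.1 v.1 + lB u.2 v.1 + rB v.2 u.1,
   brB u.2 v.2 + lA u.1 v.2 + rA v.1 u.2).

Fact sum_bracket_bilinear : bilinear_for
  (GRing.Scale.Law.clone _ _ *:%R _) (GRing.Scale.Law.clone _ _ *:%R _)
  sum_bracket.
Proof.
split=> [w|w] c u v; congr (_, _);
  rewrite /= ?linearPl ?linearPr !linearP /= ?(add_lfunE, scale_lfunE);
  by rewrite !scalerDr [X in X + _ = _]addrACA [LHS]addrACA.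
Qed.

HB.instance Definition _ :=
  bilinear_isBilinear.Build K _ _ _ _ _ sum_bracket sum_bracket_bilinear.

Definition matched_pair : Prop :=
  [/\ left_alia brA, left_alia brB & left_alia sum_bracket].

End MatchedPair.

Definition quadratic_left_alia (D : vectType K) (br : {bilinear D -> D -> D})
    (form : {symmetric D}) : Prop :=
  [/\ left_alia br, nondegenerate form &
      forall x y z : D, form (br x y) z = form x (br z y - br y z)].

Section ManinTriple.
Variable A : vectType K.

Definition dual_form (u v : A * dual A) : K :=
  pairing v.2 u.1 + pairing u.2 v.1.

Fact dual_form_bilinear : bilinear_for
  (GRing.Scale.Law.clone _ _ *%R _) (GRing.Scale.Law.clone _ _ (idfun \; *%R) _)
  dual_form.
Proof.
split=> [w|w] c u v; rewrite /dual_form /pairing /= linearP /=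
  add_lfunE scale_lfunE mulrDr; exact: addrACA.
Qed.

HB.instance Definition _ :=
  bilinear_isBilinear.Build K _ _ _ _ _ dual_form dual_form_bilinear.

Fact dual_form_sym u v :
  dual_form u v = (-1) ^+ false * idfun (dual_form v u).
Proof. by rewrite expr0 mul1r /dual_form /= addrC. Qed.

HB.instance Definition _ :=
  isHermitianSesquilinear.Build K _ false idfun dual_form dual_form_sym.

Definition manin_triple (brA : {bilinear A -> A -> A})
    (brAs : {bilinear dual A -> dual A -> dual A})
    (brd : {bilinear (A * dual A) -> (A * dual A) -> (A * dual A)}) : Prop :=
  [/\ left_alia brd,
      forall x y : A, brd (x, 0) (y, 0) = (brA x y, 0),
      forall a b : dual A, brd (0, a) (0, b) = (0, brAs a b) &
      quadratic_left_alia brd dual_form].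

End ManinTriple.

End LeftAlia.

(* Main.v *)
Require Import Defs.
From mathcomp Require Import all_boot all_order all_algebra.
From mathcomp Require Import ring.
Import GRing.Theory.
Local Open Scope ring_scope.

(* Invariance makes left multiplication skew for the form:
   [B([x,y],z) = B(x,[z,y]-[y,z]) = -B(y,[x,z])].  These two identities express
   every pairing of a mixed product [x,a^*] or [a^*,x] through the brackets of
   [A] and [A^*]; as the form is nondegenerate, the bracket of a Manin triple has
   to be the one built from the coadjoint actions.  Conversely the form is always
   invariant for that bracket, so the left-Alia identity is the only condition. *)

Section Dual.
Variables (K : fieldType) (A : vectType K).
Implicit Types (x y : A) (a b : dual A).

Lemma pairingDl a b x : pairing (a + b) x = pairing a x + pairing b x.
Proof. by rewrite /pairing add_lfunE. Qed.

Lemma pairingNl a x : pairing (- a) x = - pairing a x.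
Proof. by rewrite /pairing opp_lfunE. Qed.

Lemma pairingDr a x y : pairing a (x + y) = pairing a x + pairing a y.
Proof. exact: (linearD a). Qed.

Lemma pairingNr a x : pairing a (- x) = - pairing a x.
Proof. exact: (linearN a). Qed.

Lemma pairing0l x : pairing (0 : dual A) x = 0.
Proof. by rewrite /pairing zero_lfunE. Qed.

Lemma pairing0r a : pairing a (0 : A) = 0.
Proof. exact: (linear0 a). Qed.

Lemma pairing_injl a b : (forall x, pairing a x = pairing b x) -> a = b.
Proof. by move=> eq_ab; apply/lfunP. Qed.

(** Functionals separate points because evaluation into the bidual is injective. Under the
    identification of [A] with its bidual, this lets vectors of [A] be compared by testing them on
    [dual A]. *)
Lemma pairing_injr x y : (forall a, pairing a x = pairing a y) -> x = y.
Proof.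
move=> eq_xy; apply: (can_inj (@bidual_evK K A)); apply/lfunP => a.
by have := eq_xy a; rewrite -[pairing a x]bidual_evE -[pairing a y]bidual_evE.
Qed.

Lemma dual_form_nondegenerate : nondegenerate (@dual_form K A).
Proof.
rewrite /nondegenerate -subv0; apply/subvP => u; rewrite memv0.
move=> /mem_orthovP form_u0; case: u form_u0 => x a form_u0.
have x0 : x = 0.
  (* Each summand is isotropic, so testing against [(0, c)] sees only [x], and testing against
     [(z, 0)] sees only [a]. *)
  apply: pairing_injr => c; have := form_u0 (0, c) (memvf _).
  by rewrite /= /dual_form /= !pairing0r addr0.
have a0 : a = 0.
  apply: pairing_injl => z; have := form_u0 (z, 0) (memvf _).
  by rewrite /= /dual_form /= !pairing0l add0r.
by rewrite x0 a0.
Qed.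

End Dual.

Lemma eq_left_alia {K : fieldType} {D : vectType K}
    {br br' : {bilinear D -> D -> D}} :
  (forall x y, br x y = br' x y) -> left_alia br -> left_alia br'.
Proof. by move=> eq_br alia_br x y z; rewrite -!eq_br; apply: alia_br. Qed.

Section CoadjointActions.
Variables (K : fieldType) (A : vectType K).
Variables (brA : {bilinear A -> A -> A}).
Variables (brAs : {bilinear dual A -> dual A -> dual A}).
Implicit Types (x y z : A) (a b c : dual A).

Lemma pairing_coadL x b z :
  pairing (dual_rep (Lmul brA) x b) z = - pairing b (brA x z).
Proof. by rewrite dual_repE Lmul_E. Qed.

(** The sign in the dual representation turns left minus right into right minus left. This is
    exactly the combination [[z,y] - [y,z]] in the invariance condition. *)
Lemma pairing_coadLR y a z :
  pairing ((dual_rep (Lmul brA) - dual_rep (Rmul brA)) y a) z =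
  pairing a (brA z y) - pairing a (brA y z).
Proof.
rewrite !(add_lfunE, opp_lfunE) pairingDl pairingNl !dual_repE Lmul_E Rmul_E.
by rewrite opprK addrC.
Qed.

Lemma pairing_predual_coadL a y c :
  pairing c (predual_rep (Lmul brAs) a y) = - pairing (brAs a c) y.
Proof. by rewrite predual_repE Lmul_E. Qed.

Lemma pairing_predual_coadLR b x c :
  pairing c ((predual_rep (Lmul brAs) - predual_rep (Rmul brAs)) b x) =
  pairing (brAs c b) x - pairing (brAs b c) x.
Proof.
rewrite !(add_lfunE, opp_lfunE) pairingDr pairingNr !predual_repE Lmul_E Rmul_E.
by rewrite opprK addrC.
Qed.

End CoadjointActions.

(** The right-hand side of invariance is antisymmetric in [y] and [z]; symmetry of the form brings
    the other term to the same shape. *)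
Lemma quadratic_ad_skew {K : fieldType} {D : vectType K}
    {br : {bilinear D -> D -> D}} {form : {symmetric D}} x y z :
  quadratic_left_alia br form -> form (br x y) z = - form y (br x z).
Proof.
case=> _ _ inv.
have symF u v : form u v = form v u by rewrite hermC expr0 mul1r.
by rewrite (symF y) !inv !linearBr opprB.
Qed.

Section DoubleBracket.
Context {K : fieldType} {A : vectType K}.
Variables (brA : {bilinear A -> A -> A}).
Variables (brAs : {bilinear dual A -> dual A -> dual A}).

Definition double_bracket : {bilinear (A * dual A) -> (A * dual A) -> (A * dual A)} :=
  sum_bracket brA brAs
    (dual_rep (Lmul brA)) (dual_rep (Lmul brA) - dual_rep (Rmul brA))
    (predual_rep (Lmul brAs)) (predual_rep (Lmul brAs) - predual_rep (Rmul brAs)).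

Lemma double_bracket_invariant u v w :
  dual_form (double_bracket u v) w =
  dual_form u (double_bracket w v - double_bracket v w).
Proof.
case: u v w => [x a] [y b] [z c].
(* Once the actions are unfolded through the pairing, both sides are sums of the same scalars:
   brackets of [A] or of [A^*] paired with a third argument. *)
rewrite /dual_form /= /sum_bracket /=.
rewrite !(pairingDl, pairingNl, pairingDr, pairingNr).
rewrite !(pairing_coadL, pairing_coadLR).
rewrite !(pairing_predual_coadL, pairing_predual_coadLR).
ring.
Qed.

Lemma manin_bracketE (brd : {bilinear (A * dual A) -> (A * dual A) -> (A * dual A)}) :
  manin_triple brA brAs brd -> forall u v, brd u v = double_bracket u v.
Proof.
case=> _ brdA brdAs quad.
have inv u v w : dual_form (brd u v) w = dual_form u (brd w v - brd v w).
  by case: quad => _ _; apply.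
have skew u v w : dual_form (brd u v) w = - dual_form v (brd u w).
  exact: quadratic_ad_skew quad.
have formA t z : dual_form t (z, 0) = pairing t.2 z.
  by rewrite /dual_form /= pairing0l add0r.
have formAs t c : dual_form t (0, c) = pairing c t.1.
  by rewrite /dual_form /= pairing0r addr0.
have formE x a t : dual_form (x, a) t = pairing t.2 x + pairing a t.1 by [].
(* Against [(0, c)], invariance isolates [x] and leaves only products in [A^*]; against [(z, 0)],
   skewness isolates [b] and leaves only products in [A]. *)
have mixed x b : brd (x, 0) (0, b) =
    ((predual_rep (Lmul brAs) - predual_rep (Rmul brAs)) b x,
     dual_rep (Lmul brA) x b).
  apply: injective_projections.
    apply: pairing_injr => c; rewrite -formAs inv !brdAs pairing_predual_coadLR.
    by rewrite formE /= pairing0l addr0 pairingDl pairingNl.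
  apply: pairing_injl => z; rewrite -formA skew brdA pairing_coadL.
  by rewrite formE /= pairing0l add0r.
(* The left factor now lies in [A^*], so skewness gives the [A] component and invariance the dual
   one. *)
have mixed' a y : brd (0, a) (y, 0) =
    (predual_rep (Lmul brAs) a y,
     (dual_rep (Lmul brA) - dual_rep (Rmul brA)) y a).
  apply: injective_projections.
    apply: pairing_injr => c; rewrite -formAs skew brdAs pairing_predual_coadL.
    by rewrite formE /= pairing0l addr0.
  apply: pairing_injl => z; rewrite -formA inv !brdA pairing_coadLR.
  by rewrite formE /= pairing0r add0r pairingDr pairingNr.
have split x a : (x, a) = (x, 0) + (0, a) :> A * dual A.
  by congr (_, _); rewrite ?addr0 ?add0r.
case=> x a [y b]; rewrite {1}(split x a) {1}(split y b).
rewrite linearDl !linearDr brdA brdAs mixed mixed'.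
by congr (_, _); rewrite /= ?addr0 ?add0r; [rewrite addrAC | rewrite addrA addrC addrA].
Qed.

End DoubleBracket.

Theorem theorem4p3 (K : closedFieldType) (charK0 : [pchar K] =i pred0)
    (A : vectType K)
    (brA : {bilinear A -> A -> A})
    (brAs : {bilinear dual A -> dual A -> dual A})
    (aliaA : left_alia brA) (aliaAs : left_alia brAs) :
  (exists brd : {bilinear (A * dual A) -> (A * dual A) -> (A * dual A)},
     manin_triple brA brAs brd)
  <->
  matched_pair brA brAs
    (dual_rep (Lmul brA)) (dual_rep (Lmul brA) - dual_rep (Rmul brA))
    (predual_rep (Lmul brAs)) (predual_rep (Lmul brAs) - predual_rep (Rmul brAs)).
Proof.
split=> [[brd manin] | [_ _ aliaD]].
  have brdE := manin_bracketE _ _ _ manin; case: manin => alia_brd _ _ _.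
  by split=> //; exact: eq_left_alia brdE alia_brd.
exists (double_bracket brA brAs); split=> //.
(* On a single summand every coadjoint term has a zero argument, so the original bracket is
   recovered. *)
- by move=> x y; congr (_, _); rewrite /= ?linear0l !linear0 ?zero_lfunE !addr0.
- by move=> a b; congr (_, _); rewrite /= ?linear0l !linear0 ?zero_lfunE !addr0.
- split=> //; [exact: dual_form_nondegenerate | exact: double_bracket_invariant].
Qed.
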